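(* The formal series $T(\mathbf{u})=\sum_{\operatorname{wt}(\mathbf{k})=-1}W_{\mathbf{k}}\,\mathbf{u}^{\mathbf{k}}$ is the unique formal power series with zero constant term such that $$T(\mathbf{u})=\sum_{a\in A}\sum_{j\ge -1}u_{a,j}\,\frac{T(\mathbf{u})^{j+1}}{(j+1)!}.$$
   Context: $A$ is a finite set (of decorations), $\mathbb{K}$ is a field of characteristic zero, and $I_A:=A\times\mathbb{Z}_{\ge -1}$. A multi-index is a finitely supported map $\mathbf{k}:I_A\to\mathbb{Z}_{\ge 0}$, written $k_j^a:=\mathbf{k}(a,j)$; set $|\mathbf{k}|=\sum_{a,j}k_j^a$ and $\operatorname{wt}(\mathbf{k})=\sum_{a,j}j\,k_j^a$ (sums over $a\in A$, $j\ge -1$). $\mathbf{u}=(u_{a,j})_{a\in A,\,j\ge -1}$ is a family of commuting variables and $\mathbf{u}^{\mathbf{k}}:=\prod_{a,j}u_{a,j}^{k_j^a}$. Formal power series are formal (possibly infinite) sums $\sum_{\mathbf{k}}c_{\mathbf{k}}\mathbf{u}^{\mathbf{k}}$ over all multi-indices, with coefficients $c_{\mathbf{k}}\in\mathbb{K}$; identities and infinite sums are understood coefficientwise. An $A$-decorated rooted tree is a finite rooted tree $t$ with a map $d:V(t)\to A$; isomorphisms preserve the root and the decorations. The fertility $f(v)$ of a vertex $v$ is its number of children. The profile of $t$ is the multi-index $\mathbf{k}(t)$ with $k_j^a(t)=\#\{v\in V(t): d(v)=a,\ f(v)=j+1\}$. Let $\mathcal{F}_{\mathbf{k}}$ be the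 (finite) set of isomorphism classes of $A$-decorated rooted trees with profile $\mathbf{k}$; put $\sigma(t):=|\operatorname{Aut}(t)|$ and $$W_{\mathbf{k}}:=\sum_{t\in\mathcal{F}_{\mathbf{k}}}\frac{1}{\sigma(t)}.$$ *)

(* Defs.v *)
From HB Require Import structures.
From mathcomp Require Import all_boot all_order all_algebra all_fingroup.
From mathcomp Require Import finmap.
From mathcomp Require Import boolp classical_sets functions cardinality fsbigop.

Set Implicit Arguments.
Unset Strict Implicit.
Unset Printing Implicit Defensive.

Import Order.TTheory GRing.Theory Num.Theory.

Local Open Scope ring_scope.

(** ** Multi-indices *)

Notation Zge_m1 := {j : int | (-1 <= j)%R}.

Definition mindex (A : finType) := {fsfun (A * Zge_m1) -> nat with 0%N}.

Definition mdegree (A : finType) (k : mindex A) : nat :=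
  (\sum_(i <- finsupp k) k i)%N.

Definition weight (A : finType) (k : mindex A) : int :=
  \sum_(i <- finsupp k) val i.2 * (k i)%:Z.

Definition mzero (A : finType) : mindex A := [fsfun].

Definition munit (A : finType) (i : A * Zge_m1) : mindex A :=
  [fsfun x in [fset i]%fset => 1%N].

Lemma munitE (A : finType) (i x : A * Zge_m1) : munit i x = (x == i) :> nat.
Proof. by rewrite fsfunE inE; case: eqP. Qed.

(** ** Formal power series in the variables [u_(a, j)] *)

(* A series is the family of its coefficients. *)
Definition fps (A : finType) (K : fieldType) := mindex A -> K.

Section PowerSeries.
Variables (A : finType) (K : fieldType).
Implicit Types (S T : fps A K) (k : mindex A).

Definition fps_one : fps A K := fun k => (k == mzero A)%:R.

Definition fps_var (i : A * Zge_m1) : fps A K := fun k => (k == munit i)%:R.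

Definition splittings k : set (mindex A * mindex A) :=
  [set p : mindex A * mindex A |
    forall i, (p.1 i + p.2 i)%N = k i]%classic.

(* A sum [\sum_(x \in _)] with infinite support is 0 by convention; by
   [finite_splittings] and [tree_eq_summable] below this case never occurs. *)
Definition fps_mul S T : fps A K :=
  fun k => \sum_(p \in splittings k) S p.1 * T p.2.

Definition fps_exp T (n : nat) : fps A K := iter n (fps_mul T) fps_one.

Definition fps_scale (c : K) T : fps A K := fun k => c * T k.

Definition fps_summable (J : choiceType) (F : J -> fps A K) :=
  forall k, finite_set [set x | F x k != 0]%classic.

Definition fps_sum (J : choiceType) (F : J -> fps A K) : fps A K :=
  fun k => \sum_(x \in [set: J]%classic) F x k.

(* The term [u_(a, j) T ^ (j + 1) / (j + 1)!]; [absz] is exact as [-1 <= j]. *)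
Definition tree_eq_term T (a : A) (j : Zge_m1) : fps A K :=
  let n := absz (val j + 1) in
  fps_scale (n`!%:R)^-1 (fps_mul (fps_var (a, j)) (fps_exp T n)).

Definition tree_equation T :=
  forall k, T k = \sum_(a : A) fps_sum (tree_eq_term T a) k.

Lemma finite_splittings k : finite_set (splittings k).
Proof.
pose B := (mdegree k).+1.
pose f (g : {ffun finsupp k -> 'I_B} * {ffun finsupp k -> 'I_B})
  : mindex A * mindex A :=
  ([fsfun x : finsupp k => (g.1 x : nat)],
   [fsfun x : finsupp k => (g.2 x : nat)]).
apply: (@sub_finite_set _ _ (f @` [set: _])%classic); last first.
  by apply: finite_image; exact: finite_finset.
move=> [p q] /= pqk.
have kB i : (k i < B)%N.
  rewrite ltnS /mdegree; case: finsuppP => // ik.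
  by rewrite (big_fsetD1 i) //= leq_addr.
have pB (i : finsupp k) : (p (val i) < B)%N.
  by apply: leq_ltn_trans (kB (val i)); rewrite -pqk leq_addr.
have qB (i : finsupp k) : (q (val i) < B)%N.
  by apply: leq_ltn_trans (kB (val i)); rewrite -pqk leq_addl.
exists ([ffun i => Ordinal (pB i)], [ffun i => Ordinal (qB i)]) => //.
congr pair; apply/fsfunP => i; rewrite fsfun_ffun;
  case: insubP => [u _ <-|ik] /=; rewrite ?ffunE //.
- by have /eqP := pqk i; rewrite (fsfun_dflt ik) addn_eq0 => /andP[/eqP].
- by have /eqP := pqk i; rewrite (fsfun_dflt ik) addn_eq0 => /andP[_ /eqP].
Qed.

Lemma tree_eq_summable T a : fps_summable (tree_eq_term T a).
Proof.
move=> k.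
apply: (@sub_finite_set _ _ (snd @` [set` finsupp k])%classic); last first.
  by apply: finite_image; exact: finite_fset.
move=> j /= nz; exists (a, j) => //=; apply: contraNT nz.
rewrite mem_finsupp negbK => /eqP kj.
rewrite /tree_eq_term /fps_scale /fps_mul fsbig1 ?mulr0 // => p /= pk.
rewrite /fps_var; case: eqP => [p1|]; last by rewrite mul0r.
by have := pk (a, j); rewrite p1 munitE eqxx kj.
Qed.

End PowerSeries.

(** ** Decorated rooted trees *)

Section Trees.
Variable A : finType.

(* Root, parent map and decoration of a candidate tree with vertex set [V]. *)
Definition pretree (V : finType) : Type :=
  (V * {ffun V -> option V} * {ffun V -> A})%type.

(* The root is the only vertex without parent, and every vertex is linked to
   the root by its chain of ancestors. *)
Definition is_tree (V : finType) (t : pretree V) : bool :=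
  [forall v, (t.1.2 v == None) == (v == t.1.1)] &&
  [forall v, connect (fun x y => t.1.2 x == Some y) v t.1.1].

Record dtree (V : finType) := DTree {
  dtree_val : pretree V;
  dtree_valP : is_tree dtree_val }.

HB.instance Definition _ (V : finType) := [isSub for @dtree_val V].
HB.instance Definition _ (V : finType) := [Finite of dtree V by <:].

Section Vertices.
Variable V : finType.
Implicit Types t : dtree V.

Definition tree_root t : V := (val t).1.1.
Definition parent t : V -> option V := (val t).1.2.
Definition deco t : V -> A := (val t).2.

Definition fertility t (v : V) : nat := #|[set w | parent t w == Some v]%SET|.

Lemma fertility_ge t v : -1 <= (fertility t v)%:Z - 1.
Proof. by rewrite lerBrDr addNr. Qed.

Definition vertex_type t (v : V) : A * Zge_m1 :=
  (deco t v, Sub ((fertility t v)%:Z - 1) (fertility_ge t v)).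

(* By [profileE], the restriction to the vertex types that occur in [t], which
   makes the support finite, does not affect the values. *)
Definition profile t : mindex A :=
  [fsfun i in [fset vertex_type t v | v in V]%fset =>
    #|[set v | (deco t v == i.1) &&
               ((fertility t v)%:Z == val i.2 + 1)]%SET|].

Lemma profileE t (a : A) (j : Zge_m1) :
  profile t (a, j) =
  #|[set v | (deco t v == a) && ((fertility t v)%:Z == val j + 1)]%SET|.
Proof.
rewrite fsfunE; case: ifPn => //= /negP nin; apply/esym/eqP.
rewrite cards_eq0 -finset.subset0; apply/fintype.subsetP => v.
rewrite !inE => /andP[/eqP da].
move=> /eqP fj; case: nin; apply/imfsetP; exists v => //=.
by congr pair; [|apply/val_inj; rewrite /= fj addrK].
Qed.

Definition tree_iso t t' (s : {perm V}) : bool :=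
  [&& s (tree_root t) == tree_root t',
      [forall v, parent t' (s v) == omap s (parent t v)] &
      [forall v, deco t' (s v) == deco t v]].

Definition isomorphic t t' : bool := [exists s, tree_iso t t' s].

Definition tree_aut t : {set {perm V}} := [set s | tree_iso t t s]%SET.

Definition sigma t : nat := #|tree_aut t|.

Lemma tree_iso1 t : tree_iso t t 1%g.
Proof.
apply/and3P; split; first by rewrite perm1.
  by apply/forallP => v; rewrite perm1; case: parent => //= w; rewrite perm1.
by apply/forallP => v; rewrite perm1.
Qed.

Lemma tree_isoM t1 t2 t3 s s' :
  tree_iso t1 t2 s -> tree_iso t2 t3 s' -> tree_iso t1 t3 (s * s')%g.
Proof.
move=> /and3P[/eqP r1 /forallP p1 /forallP d1].
move=> /and3P[/eqP r2 /forallP p2 /forallP d2].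
apply/and3P; split; first by rewrite permM r1 r2.
  apply/forallP => v; rewrite permM (eqP (p2 _)) (eqP (p1 v)).
  by case: parent => //= w; rewrite permM.
by apply/forallP => v; rewrite permM (eqP (d2 _)).
Qed.

Lemma tree_isoV t t' s : tree_iso t t' s -> tree_iso t' t s^-1%g.
Proof.
move=> /and3P[/eqP r1 /forallP p1 /forallP d1]; apply/and3P; split.
- by rewrite -r1 permK.
- apply/forallP => v; have := p1 (s^-1%g v); rewrite permKV => /eqP ->.
  by case: parent => //= w; rewrite permK.
- by apply/forallP => v; have := d1 (s^-1%g v); rewrite permKV eq_sym.
Qed.

Lemma isomorphic_equiv : equivalence_rel isomorphic.
Proof.
move=> t1 t2 t3; split; first by apply/existsP; exists 1%g; exact: tree_iso1.
move=> /existsP[s s12]; apply/existsP/existsP => -[s' s's].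
  by exists (s^-1 * s')%g; apply: tree_isoM s's; exact: tree_isoV.
by exists (s * s')%g; apply: tree_isoM s's.
Qed.

Lemma sigma_iso t t' : isomorphic t t' -> sigma t = sigma t'.
Proof.
move=> /existsP[s iso_s]; rewrite /sigma -(cardJg (tree_aut t) s).
apply/eq_card => x; rewrite mem_conjg !inE conjgE invgK.
apply/idP/idP => [iso_x|iso_x].
  have -> : x = (s^-1 * ((s * (x * s^-1)) * s))%g.
    by rewrite !mulgA mulVg mul1g mulgKV.
  by apply: (tree_isoM (tree_isoV iso_s)); apply: tree_isoM iso_s.
by apply: (tree_isoM iso_s); apply: (tree_isoM iso_x); exact: tree_isoV.
Qed.

End Vertices.

(* A tree of profile [k] has exactly [mdegree k] vertices, so that every
   isomorphism class is represented on the vertex set ['I_(mdegree k)]. *)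
Definition trees_of_profile (k : mindex A) : {set dtree 'I_(mdegree k)} :=
  [set t | profile t == k]%SET.

Definition tree_classes (k : mindex A) : {set {set dtree 'I_(mdegree k)}} :=
  equivalence_partition (@isomorphic _) (trees_of_profile k).

(* The sum runs over one representative of each isomorphism class. *)
Definition W (K : fieldType) (k : mindex A) : K :=
  \sum_(t in transversal (tree_classes k) (trees_of_profile k))
    (sigma t)%:R^-1.

Definition tree_series (K : fieldType) : fps A K :=
  fun k => if weight k == -1 then W K k else 0.

End Trees.

Arguments tree_series A K : clear implicits.

(* Main.v *)
Require Import Defs.
From mathcomp Require Import all_boot all_order all_algebra.
From mathcomp Require Import finmap boolp classical_sets functions cardinality fsbigop.
From mathcomp Require Import all_fingroup.
From mathcomp Require Import fintype finset.
From mathcomp Require Import zify ring.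

(* By orbit counting, [W_k] is the number of labelled rooted trees of profile
   [k] on [n = |k|] vertices, divided by [n!]. Let [F_m] be the corresponding
   exponential generating series of forests with [m] roots. Deleting the root
   of a tree gives [F_1 = \sum_(a, j) u_(a, j) F_(j + 1)]; splitting off the tree
   below a chosen root of a forest gives [(m + 1) F_(m + 1) = F_1 F_m], whence
   [F_m = F_1 ^ m / m!]. These two facts are the functional equation of [F_1].
   Uniqueness holds because, thanks to the factor [u_(a, j)], the coefficient
   of the right-hand side at [k] depends only on coefficients of [T] of degree
   less than [|k|]. *)

Set Implicit Arguments.
Unset Strict Implicit.
Unset Printing Implicit Defensive.

Import GRing.Theory.
Local Open Scope ring_scope.

Lemma sum_widen (R : nmodType) (I : eqType) (r s : seq I) (F : I -> R) :
  uniq r -> uniq s -> {subset r <= s} -> (forall i, i \notin r -> F i = 0) ->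
  \sum_(i <- r) F i = \sum_(i <- s) F i.
Proof.
move=> ur us rs F0; rewrite [RHS](bigID (mem r)) /=.
rewrite [X in _ = _ + X]big1 ?addr0 // -[RHS]big_filter; apply: perm_big.
apply: uniq_perm; rewrite ?filter_uniq // => i; rewrite mem_filter.
by case: (boolP (i \in r)) => // /rs ->.
Qed.

(** * Multi-indices: arities, degrees and division by a variable *)

Section VertexTypes.
Variable A : finType.
Implicit Types (i : A * Zge_m1) (k : mindex A).

(** The fertility of a vertex of type [i]; [absz] loses nothing because the second component is at
    least [-1]. *)
Definition arity i : nat := absz (val i.2 + 1).

Lemma ge_m1_subn1 n : -1 <= n%:Z - 1.
Proof. by lia. Qed.

Definition mk_type (a : A) n : A * Zge_m1 := (a, Sub (n%:Z - 1) (ge_m1_subn1 n)).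

Lemma mk_type_arity i : mk_type i.1 (arity i) = i.
Proof.
case: i => a [j hj]; congr pair; apply: val_inj; rewrite /arity /=.
by lia.
Qed.

Lemma mindexP k k' : (forall i, k i = k' i) <-> k = k'.
Proof. by split=> [/fsfunP|->]. Qed.

(** The exponent of [u^k / u_i] when [0 < k i]; otherwise truncation returns [k]. *)
Definition msub k i : mindex A :=
  [fsfun x in finsupp k => (k x - (x == i))%N].

Lemma msubE k i x : msub k i x = (k x - (x == i))%N.
Proof.
rewrite fsfunE; case: ifPn => // /fsfun_dflt ->.
by rewrite sub0n.
Qed.

Lemma mdegree_widen k (S : seq (A * Zge_m1)) : uniq S ->
  {subset finsupp k <= S} -> mdegree k = (\sum_(i <- S) k i)%N.
Proof.
by move=> uS kS; apply: (sum_widen (R := nat)) => // i /fsfun_dflt.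
Qed.

Lemma mdegree_add (p q k : mindex A) : (forall i, p i + q i = k i)%N ->
  mdegree k = (mdegree p + mdegree q)%N.
Proof.
move=> pqk; have uk := fset_uniq (finsupp k).
(* Both parts are supported in the support of [k], so all three degrees become sums over one
   list. *)
rewrite (mdegree_widen (k := p) uk) => [|i]; last first.
  by rewrite !mem_finsupp -pqk; lia.
rewrite (mdegree_widen (k := q) uk) => [|i]; last first.
  by rewrite !mem_finsupp -pqk; lia.
by rewrite -big_split; apply: eq_bigr => i _; rewrite /= pqk.
Qed.

Lemma mdegree_munit i : mdegree (munit i) = 1%N.
Proof.
rewrite (@mdegree_widen _ [:: i]) // ?big_seq1 ?munitE ?eqxx //.
by move=> x; rewrite mem_finsupp munitE inE; case: (x == i).
Qed.

Lemma munit_add_msub k i : (0 < k i)%N ->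
  forall x, (munit i x + msub k i x = k x)%N.
Proof.
by move=> ki x; rewrite munitE msubE; case: (x =P i) => [->|_] /=; lia.
Qed.

Lemma mdegree_msub k i : (0 < k i)%N -> mdegree k = (mdegree (msub k i)).+1.
Proof.
by move=> /munit_add_msub /mdegree_add ->; rewrite mdegree_munit add1n.
Qed.

Lemma mdegree_eq0 k : mdegree k = 0%N -> k = mzero A.
Proof.
move=> k0; apply/mindexP => i; rewrite [RHS]fsfun0E.
suff : (k i <= mdegree k)%N by rewrite k0 leqn0 => /eqP.
rewrite /mdegree; case: (finsuppP k i) => // ik.
by rewrite (bigD1_seq i) ?fset_uniq //= leq_addr.
Qed.

End VertexTypes.

(** * Labelled forests *)

(* [None] marks the vertices outside the forest, [Some (a, None)] the roots of
   decoration [a] and [Some (a, Some w)] the vertices with parent [w]. *)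
Notation preforest A V := {ffun V -> option (A * option V)}.

Section Forests.
Variables (A V : finType).

Implicit Types (g : preforest A V) (D B : {set V}) (v w r : V).

Definition fsupp g : {set V} := [set v | g v != None].
Definition fparent g v : option V := obind snd (g v).
Definition roots_of g : {set V} := [set v in fsupp g | fparent g v == None].
Definition fert g v : nat := #|[set w | fparent g w == Some v]|.

Definition ftype g v : option (A * Zge_m1) :=
  omap (fun x => mk_type x.1 (fert g v)) (g v).

Definition fprofile g : mindex A :=
  [fsfun i in [fset i in pmap (ftype g) (enum V)]%fset =>
     #|[set v | ftype g v == Some i]|].

Lemma fprofileE g i : fprofile g i = #|[set v | ftype g v == Some i]|.
Proof.
rewrite fsfunE; case: ifPn => // /negP nin; apply/esym/eqP.
rewrite cards_eq0 -subset0; apply/subsetP => v; rewrite !inE => /eqP fv.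
case: nin; rewrite in_fset mem_pmap; apply/mapP; exists v; rewrite ?mem_enum //.
Qed.

(* Acyclicity is witnessed by a rank that decreases towards the roots. *)
Definition is_forest g : Prop :=
  (forall v w, fparent g v = Some w -> w \in fsupp g) /\
  (exists h : V -> nat, forall v w, fparent g v = Some w -> (h w < h v)%N).

Definition forests B m k : {set preforest A V} :=
  [set g | [&& `[< is_forest g >], fsupp g == B, #|roots_of g| == m &
               fprofile g == k]].

Lemma forestsP B m k g :
  reflect [/\ is_forest g, fsupp g = B, #|roots_of g| = m & fprofile g = k]
          (g \in forests B m k).
Proof.
rewrite inE; apply: (iffP and4P) => [[/asboolP ? /eqP ? /eqP ? /eqP ?]|] //.
by move=> [? -> -> ->]; split=> //; apply/asboolP.
Qed.

Lemma fsuppN g v : v \notin fsupp g -> g v = None.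
Proof. by rewrite inE negbK => /eqP. Qed.

Lemma fparent_fsupp g v w : fparent g v = Some w -> v \in fsupp g.
Proof. by rewrite /fparent inE; case: (g v). Qed.

Lemma isSome_ftype g v : (ftype g v : bool) = (v \in fsupp g).
Proof. by rewrite /ftype inE; case: (g v). Qed.

(** Double counting of the pairs of a type and a vertex of that type. The constant [phi = 1] yields
    the degree, the second component of the type yields the weight. *)
Lemma sum_ftype (M : nmodType) (phi : A * Zge_m1 -> M) g :
  \sum_(i <- finsupp (fprofile g)) phi i *+ fprofile g i =
  \sum_(v in fsupp g) oapp phi 0 (ftype g v).
Proof.
transitivity (\sum_(i <- finsupp (fprofile g)) \sum_(v in fsupp g)
    (if ftype g v == Some i then phi i else 0)).
  apply: eq_bigr => i _; rewrite -big_mkcondr sumr_const fprofileE.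
  congr (_ *+ _); apply: eq_card => v; rewrite inE [RHS]unfold_in /= inE /ftype.
  by case: (g v).
rewrite exchange_big; apply: eq_bigr => v.
rewrite -isSome_ftype; case E: (ftype g v) => [i|] // _.
have iS : i \in finsupp (fprofile g).
  rewrite mem_finsupp fprofileE cards_eq0; apply/set0Pn; exists v.
  by rewrite inE E.
rewrite (bigD1_seq i) ?fset_uniq // eqxx big1 => [|j /negPf ji]; first exact: addr0.
by rewrite (inj_eq Some_inj) eq_sym ji.
Qed.

Lemma mdegree_fprofile g : mdegree (fprofile g) = #|fsupp g|.
Proof.
have := sum_ftype (fun=> 1%N) g.
under eq_bigr do rewrite -mulr_natr mul1r natn.
rewrite -sum1_card /mdegree => ->; apply: eq_bigr => v.
by rewrite -isSome_ftype; case: ftype.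
Qed.

(** Each vertex is either a root or a child of exactly one vertex, which lies in the support by
    closure. *)
Lemma fert_root_sum g : is_forest g ->
  (\sum_(v in fsupp g) fert g v + #|roots_of g| = #|fsupp g|)%N.
Proof.
move=> [cl _]; rewrite -[#|fsupp g|](cardsID [set v | fparent g v == None]).
rewrite addnC; congr (_ + _)%N.
  by apply: eq_card => v; rewrite !inE.
rewrite -sum1_card; under eq_bigr => v do rewrite /fert -sum1_card.
rewrite (exchange_big_dep
  (fun v => v \in fsupp g :\: [set v | fparent g v == None])) /=.
  apply: eq_bigr => w; rewrite !inE => /andP[pw _].
  case E: (fparent g w) pw => [v|] // _; rewrite (big_pred1 v) // => x /=.
  rewrite inE E; apply/andP/eqP => [[_ /eqP[->]]//|->].
  by rewrite eqxx; have := cl _ _ E; rewrite inE.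
move=> v w _; rewrite !inE => /eqP E.
by rewrite E; have := fparent_fsupp E; rewrite inE.
Qed.

(** A vertex contributes its fertility minus 1, and the fertilities add up to the number of
    non-roots. *)
Lemma weight_fprofile g : is_forest g ->
  weight (fprofile g) = - (#|roots_of g|)%:Z.
Proof.
move=> fg; have := sum_ftype (fun i => val i.2) g; rewrite /weight.
under eq_bigr do rewrite -mulr_natr natz.
move=> ->; have := fert_root_sum fg.
suff -> : \sum_(v in fsupp g) oapp (fun i => val i.2) 0 (ftype g v) =
    (\sum_(v in fsupp g) fert g v)%N%:Z - #|fsupp g|%:Z by lia.
rewrite -sum1_card -!natz !natr_sum -sumrB; apply: eq_bigr => v.
by rewrite /ftype inE; case: (g v) => //= x _; rewrite natz.
Qed.

(** * Restricting a forest to a union of components *)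

Section Restriction.

Definition frestr g D : preforest A V :=
  [ffun v => if v \in D then g v else None].

(** No parent link crosses the boundary of [D]: in a forest, [D] contains each tree entirely or not
    at all. *)
Definition saturated g D := forall v w,
  fparent g v = Some w -> (v \in D) = (w \in D).

Lemma saturatedC g D : saturated g D -> saturated g (~: D).
Proof. by move=> sD v w /sD; rewrite !inE => ->. Qed.

Variables (g : preforest A V) (D : {set V}).
Hypothesis sat : saturated g D.

Lemma fparent_restr v :
  fparent (frestr g D) v = if v \in D then fparent g v else None.
Proof. by rewrite /fparent ffunE; case: ifP. Qed.

Lemma fsupp_restr : fsupp (frestr g D) = fsupp g :&: D.
Proof. by apply/setP => v; rewrite !inE ffunE; case: ifP; rewrite ?andbT ?andbF. Qed.

Lemma roots_of_restr : roots_of (frestr g D) = roots_of g :&: D.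
Proof.
by apply/setP => v; rewrite !inE fparent_restr ffunE; case: ifP; rewrite ?andbT ?andbF.
Qed.

Lemma fert_restr v : v \in D -> fert (frestr g D) v = fert g v.
Proof.
move=> vD; apply: eq_card => w; rewrite !inE fparent_restr.
case: ifPn => // wD; apply/esym/eqP => E.
by move: wD; rewrite (sat E) vD.
Qed.

Lemma ftype_restr v :
  ftype (frestr g D) v = if v \in D then ftype g v else None.
Proof.
by rewrite /ftype ffunE; case: ifP => // vD; rewrite fert_restr.
Qed.

Lemma forest_restr : is_forest g -> is_forest (frestr g D).
Proof.
move=> [cl [h hP]]; split=> [v w|]; last first.
  by exists h => v w; rewrite fparent_restr; case: ifP => // _ /hP.
rewrite fparent_restr fsupp_restr; case: ifP => // vD E.
by rewrite inE (cl _ _ E) -(sat E).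
Qed.

End Restriction.

(** The children of a vertex stay on its side, so types survive restriction and each vertex is
    counted on exactly one side. *)
Lemma fprofile_restr g D i : saturated g D ->
  (fprofile (frestr g D) i + fprofile (frestr g (~: D)) i = fprofile g i)%N.
Proof.
move=> sD; rewrite !fprofileE -[RHS](cardsID D); congr (_ + _)%N;
  apply: eq_card => v; rewrite !inE ftype_restr //; try exact: saturatedC.
- by case: ifP; rewrite ?andbT ?andbF.
- by rewrite inE; case: (v \in D).
Qed.

(** * Gluing two forests with complementary supports *)

Definition funion g1 g2 : preforest A V :=
  [ffun v => if g1 v is Some x then Some x else g2 v].

Lemma funion_restr g D : funion (frestr g D) (frestr g (~: D)) = g.
Proof. by apply/ffunP => v; rewrite !ffunE inE; case: (v \in D); case: (g v). Qed.

Section Union.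
Variables (g1 g2 : preforest A V).
Hypotheses (f1 : is_forest g1) (f2 : is_forest g2).
Hypothesis (supp2 : fsupp g2 = ~: fsupp g1).

Let g := funion g1 g2.

Lemma funionE v : g v = if v \in fsupp g1 then g1 v else g2 v.
Proof. by rewrite ffunE inE; case: (g1 v). Qed.

Lemma fparent_union v :
  fparent g v = if v \in fsupp g1 then fparent g1 v else fparent g2 v.
Proof. by rewrite /fparent funionE; case: ifP. Qed.

Lemma funion_saturated : saturated g (fsupp g1).
Proof.
move=> v w; rewrite fparent_union; case: ifP => _ E.
  by rewrite (f1.1 _ _ E).
by have := f2.1 _ _ E; rewrite supp2 inE => /negPf.
Qed.

Lemma restr_unionl : frestr g (fsupp g1) = g1.
Proof.
by apply/ffunP => v; rewrite ffunE funionE; case: (boolP (v \in _)) => // /fsuppN ->.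
Qed.

Lemma restr_unionr : frestr g (~: fsupp g1) = g2.
Proof.
apply/ffunP => v; rewrite ffunE in_setC funionE; case: (boolP (v \in _)) => //= v1.
by rewrite fsuppN // supp2 in_setC v1.
Qed.

Lemma fsupp_union : fsupp g = setT.
Proof.
apply/setP => v; rewrite [RHS]inE; have := in_setC v (fsupp g1).
by rewrite -supp2 !inE ffunE; case: (g1 v).
Qed.

Lemma forest_union : is_forest g.
Proof.
split=> [v w _|]; first by rewrite fsupp_union inE.
have [[_ [h1 h1P]] [_ [h2 h2P]]] := (f1, f2).
(* The two ranks need no comparison, as no parent link joins the two supports. *)
exists (fun v => if v \in fsupp g1 then h1 v else h2 v) => v w E.
have := funion_saturated E; move: E; rewrite fparent_union.
by case: ifP => _ E <-; [exact: h1P|exact: h2P].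
Qed.

End Union.

(** * The tree below a root *)

Definition descendants g r : {set V} :=
  [set v | connect (fun x y => fparent g x == Some y) v r].

Lemma root_parent g r : r \in roots_of g -> fparent g r = None.
Proof. by rewrite inE => /andP[_ /eqP]. Qed.

(** A path to [r] from a vertex with a parent is not empty, since [r] has no parent, and so passes
    through that parent. *)
Lemma desc_saturated g r : r \in roots_of g -> saturated g (descendants g r).
Proof.
move=> /root_parent rr v w E; rewrite !inE; apply/idP/idP => [|H]; last first.
  by apply: connect_trans H; apply: connect1; rewrite E.
case/connectP => [[|x p]] /=; first by move=> _ vr; move: E; rewrite -vr rr.
by rewrite E => /andP[/eqP[<-] pxp] ->; apply/connectP; exists p.
Qed.

Lemma desc_root g r : r \in roots_of g ->
  roots_of g :&: descendants g r = [set r].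
Proof.
move=> rr; apply/setP => v; rewrite in_setI in_set1 [v \in descendants g r]inE.
apply/andP/eqP => [[/root_parent vr]|->]; last by rewrite connect0.
by case/connectP => [[|x p]] //=; rewrite vr.
Qed.

(** Climbing from a vertex to its root preserves membership in a saturated set; the induction is on
    the rank. *)
Lemma saturated_eq g D1 D2 : is_forest g -> saturated g D1 -> saturated g D2 ->
  D1 \subset fsupp g -> D2 \subset fsupp g ->
  roots_of g :&: D1 = roots_of g :&: D2 -> D1 = D2.
Proof.
move=> [_ [h hP]] s1 s2 /subsetP D1g /subsetP D2g eqr; apply/setP => v.
have [n] := ubnP (h v); elim: n v => // n IH v hv.
case E: (fparent g v) => [w|].
  by rewrite (s1 _ _ E) (s2 _ _ E) IH //; have := hP _ _ E; lia.
have [vg|vg] := boolP (v \in fsupp g).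
  move/setP/(_ v): eqr; rewrite !in_setI.
  by have -> : v \in roots_of g by rewrite inE vg E.
by rewrite (contraNF (D1g v)) // (contraNF (D2g v)).
Qed.

Lemma forest_root g v : is_forest g ->
  v \in fsupp g -> exists r, r \in roots_of g.
Proof.
move=> [cl [h hP]]; have [n] := ubnP (h v); elim: n v => // n IH v hv vg.
case E: (fparent g v) => [w|]; last by exists v; rewrite inE vg E.
by apply: (IH w); [have := hP _ _ E; lia|apply: cl E].
Qed.

End Forests.

(** * Splitting off the tree below a root *)

Section Split.
Variables (A V : finType) (m : nat) (k : mindex A).

Definition rooted_forests : {set preforest A V * V} :=
  [set x | (x.1 \in forests setT m.+1 k) && (x.2 \in roots_of x.1)].

(** The image of splitting: a tree, and a forest on the complementary vertices. *)
Definition forest_pairs : {set preforest A V * preforest A V} :=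
  [set y | [&& `[< is_forest y.1 >], `[< is_forest y.2 >],
     fsupp y.2 == ~: fsupp y.1, #|roots_of y.1| == 1%N, #|roots_of y.2| == m &
     (fprofile y.1, fprofile y.2) \in splittings k]].

Lemma forest_pairsP y : reflect
  [/\ is_forest y.1 /\ is_forest y.2, fsupp y.2 = ~: fsupp y.1,
      exists r, roots_of y.1 = [set r], #|roots_of y.2| = m &
      forall i, fprofile y.1 i + fprofile y.2 i = k i]%N
  (y \in forest_pairs).
Proof.
rewrite inE; apply: (iffP and5P) => [[/asboolP ? /asboolP ? /eqP ?]|].
  by move=> /cards1P ? /andP[/eqP ? /set_mem].
move=> [[? ?] -> [r ->] -> pk]; split; try exact/asboolP; rewrite ?cards1 //.
by rewrite eqxx; apply/mem_set.
Qed.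

Lemma card_rooted_forests :
  #|rooted_forests| = (m.+1 * #|forests (V := V) setT m.+1 k|)%N.
Proof.
rewrite mulnC -sum_nat_const -sum1_card.
under [RHS]eq_bigr => g /forestsP[_ _ <- _] do rewrite -sum1_card.
by rewrite pair_big_dep /=; apply: eq_bigl => x; rewrite inE.
Qed.

Definition split_root (x : preforest A V * V) :=
  (frestr x.1 (descendants x.1 x.2), frestr x.1 (~: descendants x.1 x.2)).

(** Gluing the pieces returns the forest, and the chosen root is the only root of the first
    piece. *)
Lemma split_root_inj : {in rooted_forests &, injective split_root}.
Proof.
move=> [g r] [g' r']; rewrite inE => /andP[_ /= rg].
rewrite inE => /andP[_ /= rg'] [e1 e2].
have eg : g = g'.
  by rewrite -(funion_restr g (descendants g r)) e1 e2 funion_restr.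
subst g'; congr pair; apply: set1_inj; rewrite -(desc_root rg) -(desc_root rg').
by rewrite -!roots_of_restr e1.
Qed.

Lemma split_root_image : split_root @: rooted_forests = forest_pairs.
Proof.
apply/setP => -[g1 g2]; apply/imsetP/forest_pairsP => /= [[[g r]]|].
  rewrite inE => /andP[/forestsP[/= fg sg rg pg] rr] [-> ->].
  have sD := desc_saturated rr; have sC := saturatedC sD.
  split.
  - by split; apply: forest_restr.
  - by rewrite !fsupp_restr sg !setTI.
  - by exists r; rewrite roots_of_restr desc_root.
  - rewrite roots_of_restr; apply/eqP; rewrite -(eqn_add2l 1); apply/eqP.
    rewrite [RHS]add1n -rg -[#|roots_of g|](cardsID (descendants g r)).
    by rewrite desc_root // cards1 setDE.
  - by move=> i; rewrite fprofile_restr // pg.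
move=> [[f1 f2] s2 [r r1] r2 pk].
have rg : roots_of (funion g1 g2) :&: fsupp g1 = [set r].
  by rewrite -roots_of_restr restr_unionl.
have rr : r \in roots_of (funion g1 g2).
  by have := set11 r; rewrite -rg inE => /andP[].
have sat := funion_saturated f1 f2 s2; have supp := fsupp_union s2.
have fg := forest_union f1 f2 s2.
(* Both sets are saturated and meet the roots only in [r], so [saturated_eq] identifies them. *)
have dE : descendants (funion g1 g2) r = fsupp g1.
  apply: (saturated_eq fg) => //; rewrite ?supp ?subsetT ?desc_root //.
  exact: desc_saturated.
exists (funion g1 g2, r); last first.
  by rewrite /split_root /= dE restr_unionl restr_unionr.
rewrite inE /= rr andbT; apply/forestsP; split => //.
  rewrite -(cardsID (fsupp g1)) rg cards1 setDE -roots_of_restr restr_unionr //.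
  by rewrite r2 add1n.
apply/mindexP => i; rewrite -(fprofile_restr _ sat) restr_unionl restr_unionr //.
Qed.

(** Pairs are sorted by the vertex set [D] of the tree, then by the two profiles. *)
Lemma card_forest_pairs : #|forest_pairs| =
  (\sum_(D : {set V}) \sum_(p <- fset_set (splittings k))
     #|forests D 1 p.1| * #|forests (~: D) m p.2|)%N.
Proof.
rewrite -sum1_card (partition_big (fun y => fsupp y.1) predT) //=.
apply: eq_bigr => D _.
under [RHS]eq_bigr do rewrite -cardsX -sum1_card big_mkcond.
rewrite exchange_big big_mkcond; apply: eq_bigr => -[g1 g2] _.
have mem_pairs p :
    (g1, g2) \in finset.setX (forests D 1 p.1) (forests (~: D) m p.2) ->
    p = (fprofile g1, fprofile g2) /\ fsupp g1 = D.
  by rewrite inE /= => /andP[/forestsP[_ -> _ ->] /forestsP[_ _ _ ->]]; case: p.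
case: ifPn => [/andP[/forest_pairsP /= [[f1 f2] s2 [r r1] r2 pk] /eqP sD]|nin].
  (* A pair is counted for one splitting only, that of its own profiles. *)
  have pS : (fprofile g1, fprofile g2) \in fset_set (splittings k).
    by rewrite in_fset_set; [exact/mem_set|exact: finite_splittings].
  rewrite (bigD1_seq _ pS) ?fset_uniq // big1 => [|p np].
    rewrite ifT ?addn0 // inE; apply/andP.
    by split; apply/forestsP; rewrite ?r1 ?cards1 // -sD.
  by case: ifP => // /mem_pairs[pE _]; rewrite pE eqxx in np.
rewrite big_seq big1 // => p pS; case: ifP => // gp; case/negP: nin.
have [pE sD] := mem_pairs _ gp.
rewrite in_fset_set in pS; last exact: finite_splittings.
move: gp; rewrite inE => /andP[/forestsP[f1 s1 r1 p1] /forestsP[f2 s2 r2 p2]].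
apply/andP; split; last exact/eqP.
apply/forest_pairsP; split => //=; first by rewrite s1.
  by apply/cards1P; rewrite r1.
by move=> i; rewrite p1 p2; move/set_mem: pS => /(_ i).
Qed.

Lemma forests_split :
  (m.+1 * #|forests (V := V) setT m.+1 k| =
   \sum_(D : {set V}) \sum_(p <- fset_set (splittings k))
     #|forests D 1 p.1| * #|forests (~: D) m p.2|)%N.
Proof.
rewrite -card_rooted_forests -card_forest_pairs -split_root_image.
by rewrite (card_in_imset split_root_inj).
Qed.

End Split.

(** * Deleting the root of a tree *)

Section RootRemoval.
Variables (A V : finType) (r : V) (a : A).
Implicit Types g : preforest A V.

(** [odflt r] hangs the former roots below [r]; the other vertices of the forest keep their
    parent. *)
Definition add_root g : preforest A V :=
  [ffun v => if v == r then Some (a, None) else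
     omap (fun x => (x.1, Some (odflt r x.2))) (g v)].

Definition del_root g : preforest A V :=
  [ffun v => if v == r then None else
     omap (fun x => (x.1, if x.2 == Some r then None else x.2)) (g v)].

Section AddRoot.
Variable g : preforest A V.
Hypotheses (fg : is_forest g) (sg : fsupp g = ~: [set r]).

Lemma fsuppC1 v : (g v != None) = (v != r).
Proof. by have := in_setC1 v r; rewrite -sg inE. Qed.

Lemma fparent_add_root v : fparent (add_root g) v =
  if v == r then None else Some (odflt r (fparent g v)).
Proof.
rewrite /fparent ffunE; have := fsuppC1 v.
by case: (v == r) => //; case: (g v) => // -[b [w|]].
Qed.

Lemma fparent_neq v : fparent g v != Some r.
Proof. by apply/eqP => /fg.1; rewrite sg !inE eqxx. Qed.

Lemma fert_add_root v : v != r -> fert (add_root g) v = fert g v.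
Proof.
move=> vr; apply: eq_card => w; rewrite !inE fparent_add_root.
have := fsuppC1 w; rewrite /fparent; case: (w == r) => /= [/negbFE/eqP -> //|].
case: (g w) => // -[b [x|]] //= _.
by rewrite (inj_eq Some_inj) eq_sym (negPf vr).
Qed.

Lemma fert_add_root_root : fert (add_root g) r = #|roots_of g|.
Proof.
apply: eq_card => w; rewrite !inE fparent_add_root fsuppC1.
case: (w == r) => //=; have := fparent_neq w; case: (fparent g w) => [x|] /=.
  by rewrite (inj_eq Some_inj) => /negPf.
by rewrite eqxx.
Qed.

Lemma ftype_add_root v : ftype (add_root g) v =
  if v == r then Some (mk_type a #|roots_of g|) else ftype g v.
Proof.
rewrite /ftype ffunE; case: eqP => [->|/eqP vr] /=.
  by rewrite fert_add_root_root.
by rewrite fert_add_root //; case: (g v).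
Qed.

Lemma fprofile_add_root i :
  fprofile (add_root g) i = (munit (mk_type a #|roots_of g|) i + fprofile g i)%N.
Proof.
rewrite !fprofileE munitE (cardD1 r) inE ftype_add_root eqxx.
rewrite (inj_eq Some_inj) eq_sym; congr (_ + _)%N; apply: eq_card => v.
rewrite !inE ftype_add_root; case: eqP => [->|//] /=.
by have := fsuppC1 r; rewrite eqxx /ftype => /negbFE/eqP ->.
Qed.

Lemma fsupp_add_root : fsupp (add_root g) = setT.
Proof.
apply/setP => v; rewrite !inE ffunE; have := fsuppC1 v.
by case: (v == r) => //; case: (g v).
Qed.

Lemma roots_of_add_root : roots_of (add_root g) = [set r].
Proof.
apply/setP => v; rewrite !inE; have := fsupp_add_root.
by move/setP/(_ v); rewrite !inE fparent_add_root => ->; case: (v == r).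
Qed.

Lemma forest_add_root : is_forest (add_root g).
Proof.
split=> [v w _|]; first by rewrite fsupp_add_root inE.
have [_ [h hP]] := fg.
(* The shift by one leaves room for [r] below former roots of rank 0. *)
exists (fun v => if v == r then 0 else (h v).+1)%N => v w.
rewrite fparent_add_root; case: eqP => // _ [<-].
case E: (fparent g v) => [x|] /=; last by rewrite eqxx.
by have := hP _ _ E; case: eqP.
Qed.

Lemma add_rootK : del_root (add_root g) = g.
Proof.
apply/ffunP => v; rewrite !ffunE; have := fsuppC1 v; have := fparent_neq v.
rewrite /fparent; case: (v == r) => /= [_ /negbFE/eqP -> //|].
case: (g v) => // -[b [w|]] //= H _; first by rewrite (negPf H).
by rewrite eqxx.
Qed.

End AddRoot.

Section DelRoot.
Variable g : preforest A V.
Hypotheses (fg : is_forest g) (sg : fsupp g = setT) (rg : roots_of g = [set r]).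
Hypothesis ga : g r = Some (a, None).

Lemma fsupp_del_root : fsupp (del_root g) = ~: [set r].
Proof.
apply/setP => v; rewrite !inE ffunE; have := in_setT v; rewrite -sg inE.
by case: (v == r) => //; case: (g v).
Qed.

Lemma fparent_del_root v w : fparent (del_root g) v = Some w ->
  fparent g v = Some w /\ w != r.
Proof.
rewrite /fparent ffunE; case: (v == r) => //; case: (g v) => // -[b [x|]] //=.
by case: eqP => // xr [<-]; split=> //; apply/eqP => E; case: xr; rewrite E.
Qed.

Lemma forest_del_root : is_forest (del_root g).
Proof.
split=> [v w /fparent_del_root[_]|]; first by rewrite fsupp_del_root !inE.
by have [_ [h hP]] := fg; exists h => v w /fparent_del_root[/hP].
Qed.

Lemma del_rootK : add_root (del_root g) = g.
Proof.
apply/ffunP => v; rewrite !ffunE; case: eqP => [->|/eqP vr]; first by rewrite ga.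
have := in_set1 v r; rewrite -rg inE /fparent (negPf vr); have := in_setT v.
rewrite -sg inE; case: (g v) => [[b [w|]]|] //= _ _.
by case: eqP => [[->]|].
Qed.

End DelRoot.

(** [add_root] is a bijection between the two sets: the arity of the root [r] is the number of roots
    left after deleting it. *)
Lemma card_add_root m (p k : mindex A) :
  (forall i, munit (mk_type a m) i + p i = k i)%N ->
  #|[set g in forests setT 1 k |
      (r \in roots_of g) && (ftype g r == Some (mk_type a m))]| =
  #|forests (~: [set r]) m p|.
Proof.
move=> pk; rewrite -(card_in_imset (f := add_root)
  (D := mem (forests (~: [set r]) m p))).
  apply: eq_card => g; rewrite inE.
  apply/and3P/imsetP => [|[g' /forestsP[fg sg rg pg] ->]].
    move=> [/forestsP[fg sg /eqP/cards1P[r' rg] pg] rr /eqP tr].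
    have {r' rg rr} rg : roots_of g = [set r].
      by move: rr; rewrite rg inE => /eqP ->.
    have ga : g r = Some (a, None).
      have : fparent g r = None by apply: root_parent; rewrite rg set11.
      by move: tr; rewrite /fparent /ftype; case: (g r) => //= -[b o] [-> _] /= ->.
    have fd := forest_del_root fg sg; have sd := fsupp_del_root sg.
    have eg := del_rootK sg rg ga.
    have mE : #|roots_of (del_root g)| = m.
      rewrite -(fert_add_root_root fd sd) eg; move: tr; rewrite /ftype ga /=.
      by case; lia.
    exists (del_root g) => //; apply/forestsP; split => //.
    apply/mindexP => i; apply/eqP; rewrite -(eqn_add2l (munit (mk_type a m) i)).
    by rewrite pk -[in X in mk_type a X]mE -fprofile_add_root // eg pg.
  split.
  - apply/forestsP; split; rewrite ?fsupp_add_root ?roots_of_add_root ?cards1 //.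
      exact: forest_add_root.
    by apply/mindexP => i; rewrite fprofile_add_root // rg pg pk.
  - by rewrite roots_of_add_root // set11.
  - by rewrite ftype_add_root // eqxx rg.
move=> g g' /forestsP[fg sg _ _] /forestsP[fg' sg' _ _] /(congr1 del_root).
by rewrite !add_rootK.
Qed.

End RootRemoval.

(** A tree is counted once, at its only root [r] and the type [i] of that root; [card_add_root]
    counts each case. *)
Lemma forests_root (A V : finType) (k : mindex A) :
  (#|forests (V := V) setT 1 k| =
   \sum_(r : V) \sum_(i <- finsupp k)
     #|forests (~: [set r]) (arity i) (msub k i)|)%N.
Proof.
transitivity (\sum_(r : V) \sum_(i <- finsupp k)
    #|[set g in forests setT 1 k |
         (r \in roots_of g) && (ftype g r == Some i)]|)%N.
  under eq_bigr => r _ do under eq_bigr => i _ do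
    rewrite -sum1_card big_mkcond.
  under eq_bigr => r _ do rewrite exchange_big.
  rewrite exchange_big -sum1_card big_mkcond; apply: eq_bigr => g _.
  case: ifPn => [gF|gF]; last first.
    by rewrite big1 // => r _; rewrite big1 // => i _; rewrite in_set (negPf gF).
  have /forestsP[_ sg /eqP/cards1P[r rg] pg] := gF.
  have : r \in fsupp g by rewrite sg inE.
  rewrite -isSome_ftype; case ti: (ftype g r) => [i|] // _.
  have iS : i \in finsupp k.
    rewrite -pg mem_finsupp fprofileE cards_eq0; apply/set0Pn; exists r.
    by rewrite inE ti.
  rewrite (bigD1 r) // [X in _ = _ X]big1 => [|r' r'r]; last first.
    by rewrite big1 // => j _; rewrite in_set rg in_set1 (negPf r'r) andbF.
  rewrite (bigD1_seq i) ?fset_uniq // big1 => [|j ji]; last first.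
    by rewrite in_set ti (inj_eq Some_inj) eq_sym (negPf ji) !andbF.
  by rewrite in_set gF rg set11 ti eqxx.
apply: eq_bigr => r _; rewrite big_seq [RHS]big_seq; apply: eq_bigr => i iS.
have := @card_add_root _ _ r i.1 (arity i) (msub k i) k; rewrite mk_type_arity.
by apply; apply: munit_add_msub; rewrite lt0n -mem_finsupp.
Qed.

(** * Independence of the vertex set *)

Section Transport.
Variables (A U V : finType) (h : U -> V).
Hypothesis inj_h : injective h.
Implicit Types (f : preforest A U) (g : preforest A V).

Definition push_forest f : preforest A V :=
  [ffun v => obind (fun u => omap (fun x => (x.1, omap h x.2)) (f u))
                   [pick u | h u == v]].

(** Inverse of [push_forest] on forests whose support is the image of [h]. A parent outside the
    image would be dropped; in [pullK] closure of the support excludes this. *)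
Definition pull_forest g : preforest A U :=
  [ffun u => omap (fun x => (x.1, obind (fun w => [pick z | h z == w]) x.2))
                  (g (h u))].

Lemma pick_inj u : [pick z | h z == h u] = Some u.
Proof. by case: pickP => [z /eqP/inj_h -> //|/(_ u)]; rewrite eqxx. Qed.

Lemma pushE f u : push_forest f (h u) = omap (fun x => (x.1, omap h x.2)) (f u).
Proof. by rewrite ffunE pick_inj. Qed.

Lemma push_cases f v : push_forest f v = None \/ exists u, v = h u.
Proof.
case: (pickP (fun u => h u == v)) => [u /eqP <-|no]; first by right; exists u.
by left; rewrite ffunE; case: pickP => // u; rewrite no.
Qed.

Lemma fparent_push f u : fparent (push_forest f) (h u) = omap h (fparent f u).
Proof. by rewrite /fparent pushE; case: (f u). Qed.

Lemma fparent_pushP f v w : fparent (push_forest f) v = Some w ->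
  exists x y, [/\ v = h x, w = h y & fparent f x = Some y].
Proof.
have [E|[u ->]] := push_cases f v; first by rewrite /fparent E.
by rewrite fparent_push; case E: (fparent f u) => [y|] //= [<-]; exists u, y.
Qed.

Lemma fsupp_push f : fsupp (push_forest f) = h @: fsupp f.
Proof.
apply/setP => v; have [E|[u ->]] := push_cases f v.
  apply/idP/imsetP => [|[u uf vu]]; first by rewrite inE E.
  by move: E uf; rewrite vu pushE inE; case: (f u).
by rewrite mem_imset // !inE pushE; case: (f u).
Qed.

Lemma roots_of_push f : roots_of (push_forest f) = h @: roots_of f.
Proof.
apply/setP => v; have [E|[u ->]] := push_cases f v.
  apply/idP/imsetP => [|[u uf vu]]; first by rewrite !inE E.
  by move: E uf; rewrite vu pushE !inE; case: (f u).
by rewrite mem_imset // !inE fparent_push pushE /fparent; case: (f u) => // -[? []].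
Qed.

Lemma fert_push f u : fert (push_forest f) (h u) = fert f u.
Proof.
rewrite /fert -[RHS](card_imset _ inj_h); apply: eq_card => w; rewrite inE.
apply/eqP/imsetP => [/fparent_pushP[x [y [-> /inj_h-> E]]]|[x]].
  by exists x => //; rewrite inE E.
by rewrite inE => /eqP E ->; rewrite fparent_push E.
Qed.

Lemma ftype_push f u : ftype (push_forest f) (h u) = ftype f u.
Proof. by rewrite /ftype fert_push pushE; case: (f u). Qed.

Lemma fprofile_push f : fprofile (push_forest f) = fprofile f.
Proof.
apply/mindexP => i; rewrite !fprofileE -[RHS](card_imset _ inj_h).
apply: eq_card => v; have [E|[u ->]] := push_cases f v; last first.
  by rewrite mem_imset // !inE ftype_push.
rewrite inE /ftype E; apply/esym/imsetP => -[u]; rewrite inE => uf vu.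
by move: E uf; rewrite vu pushE /ftype; case: (f u).
Qed.

Lemma forest_push f : is_forest (push_forest f) <-> is_forest f.
Proof.
split=> -[cl [rk rkP]]; split.
- move=> x y E; rewrite -(mem_imset _ _ inj_h) -fsupp_push.
  by apply: (cl (h x)); rewrite fparent_push E.
- by exists (rk \o h) => x y E; apply: rkP; rewrite fparent_push E.
- move=> v w /fparent_pushP[x [y [_ -> /cl]]].
  by rewrite fsupp_push mem_imset.
(* The default 0 is harmless: by [fparent_pushP] both ends of a parent link lie in the image of
   [h]. *)
exists (fun v => oapp rk 0%N [pick u | h u == v]).
by move=> v w /fparent_pushP[x [y [-> -> /rkP]]]; rewrite !pick_inj.
Qed.

Lemma pushK : cancel push_forest pull_forest.
Proof.
move=> f; apply/ffunP => u; rewrite ffunE pushE; case: (f u) => // -[a [w|]] //=.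
by rewrite pick_inj.
Qed.

Lemma pullK g : is_forest g -> fsupp g = h @: setT ->
  push_forest (pull_forest g) = g.
Proof.
move=> [cl _] sg; apply/ffunP => v.
have [/imsetP[u _ ->]|vg] := boolP (v \in h @: setT).
  rewrite pushE ffunE; have := cl (h u); rewrite /fparent.
  case: (g (h u)) => // -[a [w|]] //= /(_ w erefl); rewrite sg => /imsetP[x _ ->].
  by rewrite pick_inj.
rewrite (fsuppN (g := g)) ?sg // ffunE; case: pickP => //= u /eqP E.
by move: vg; rewrite -E imset_f ?in_setT.
Qed.

Lemma card_forests_push m (k : mindex A) :
  #|forests (h @: [set: U]) m k| = #|forests (V := U) setT m k|.
Proof.
rewrite -(card_imset _ (can_inj pushK)); apply: eq_card => g.
apply/idP/imsetP => [/forestsP[fg sg rg pg]|[f /forestsP[ff sf rf pf] ->]]; last first.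
  apply/forestsP; split; rewrite ?fsupp_push ?sf ?roots_of_push ?card_imset //.
    exact/forest_push.
  by rewrite fprofile_push.
have E := pullK fg sg; exists (pull_forest g) => //; apply/forestsP; split.
- by apply/forest_push; rewrite E.
- by apply: (imset_inj inj_h); rewrite -fsupp_push E.
- by rewrite -rg -[in RHS]E roots_of_push card_imset.
- by rewrite -pg -[in RHS]E fprofile_push.
Qed.

End Transport.

(** [enum_val] is an injection from an ordinal type with image [B], so only the size of [B]
    matters. *)
Lemma card_forests_ord (A V : finType) (B : {set V}) n m (k : mindex A) :
  #|B| = n -> #|forests B m k| = #|forests (V := 'I_n) setT m k|.
Proof.
move=> <-; rewrite -(card_forests_push (@enum_val_inj _ (mem B))).
congr #|pred_of_set _|.
congr forests; apply/setP => v; apply/idP/imsetP => [vB|[x _ ->]].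
  by exists (enum_rank_in vB v); rewrite ?enum_rankK_in.
exact: enum_valP.
Qed.

Lemma forests_eq0 (A V : finType) (B : {set V}) m (k : mindex A) :
  #|B| <> mdegree k -> forests B m k = set0.
Proof.
move=> Bk; apply/setP => g; rewrite in_set0; apply/forestsP => -[_ sg _ pg].
by apply: Bk; rewrite -sg -pg mdegree_fprofile.
Qed.

(** * Trees up to isomorphism *)

Section TreeForest.
Variables (A V : finType).
Implicit Types t : dtree A V.

Definition tree_forest t : preforest A V :=
  [ffun v => Some (deco t v, parent t v)].

Lemma fparent_tree t v : fparent (tree_forest t) v = parent t v.
Proof. by rewrite /fparent ffunE. Qed.

Lemma fsupp_tree t : fsupp (tree_forest t) = setT.
Proof. by apply/setP => v; rewrite !inE ffunE. Qed.

Lemma parent_root t v : (parent t v == None) = (v == tree_root t).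
Proof. by have /andP[/forallP/(_ v)/eqP] := valP t. Qed.

Lemma roots_of_tree t : roots_of (tree_forest t) = [set tree_root t].
Proof.
by apply/setP => v; rewrite 2!inE fsupp_tree fparent_tree parent_root !inE.
Qed.

Lemma forest_tree t : is_forest (tree_forest t).
Proof.
split=> [v w _|]; first by rewrite fsupp_tree inE.
(* The rank of [v] is its depth, the least [n] such that the [n]-th ancestor [anc n v] is the
   root. *)
pose anc n v := iter n (obind (parent t)) (Some v).
have anc_root v : exists n, anc n v == Some (tree_root t).
  have /andP[_ /forallP/(_ v)/connectP[p]] := valP t.
  rewrite -/(tree_root t) -/(parent t) => vp ->; exists (size p); apply/eqP.
  elim: p v vp => //= w p IH v /andP[/eqP vw /IH <-].
  by rewrite /anc -iterS iterSr /= -[X in X v]/(parent t) vw.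
exists (fun v => ex_minn (anc_root v)) => v w; rewrite fparent_tree => vw.
case: ex_minnP => i _ min_i; case: ex_minnP => -[|j] vj _.
  by move: vj; rewrite /anc /= (inj_eq Some_inj) -parent_root vw.
by apply: min_i; move: vj; rewrite /anc iterSr /= vw.
Qed.

Lemma ftype_tree t v : ftype (tree_forest t) v = Some (vertex_type t v).
Proof.
rewrite /ftype ffunE /=; congr Some; congr pair; apply: val_inj => /=.
by congr (Posz _ - 1); apply: eq_card => w; rewrite !inE fparent_tree.
Qed.

Lemma fprofile_tree t : fprofile (tree_forest t) = profile t.
Proof.
apply/mindexP => -[a j]; rewrite fprofileE profileE; apply: eq_card => v.
rewrite !inE ftype_tree (inj_eq Some_inj) xpair_eqE; congr andb.
by rewrite -val_eqE /= subr_eq.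
Qed.

Lemma tree_forest_inj : injective tree_forest.
Proof.
move=> t t' /ffunP E; have Ev v := E v.
have Ep v : parent t v = parent t' v by have := Ev v; rewrite !ffunE => -[].
have Ed v : deco t v = deco t' v by have := Ev v; rewrite !ffunE => -[].
have Er : tree_root t = tree_root t'.
  by apply/eqP; rewrite -parent_root -Ep parent_root.
apply: val_inj; rewrite /tree_root /parent /deco in Er Ep Ed *.
case: (val t) (val t') Er Ep Ed => [[r p] d] [[r' p'] d'] /= -> Ep Ed.
by congr (_, _, _); apply/ffunP.
Qed.

(** [tree_forest] is a bijection onto these forests; for surjectivity, the rank must yield a path
    from each vertex to the root. *)
Lemma card_trees (k : mindex A) :
  #|[set t : dtree A V | profile t == k]| = #|forests (V := V) setT 1 k|.
Proof.
rewrite -(card_imset _ tree_forest_inj); apply: eq_card => g.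
apply/imsetP/idP => [[t] | /forestsP[fg sg /eqP/cards1P[r rg] pg]].
  rewrite inE => /eqP tk ->; apply/forestsP; split.
  - exact: forest_tree.
  - exact: fsupp_tree.
  - by rewrite roots_of_tree cards1.
  - by rewrite fprofile_tree.
have gN v : g v != None by have := in_setT v; rewrite -sg inE.
(* [oapp] needs a default decoration; the root supplies one. *)
have [a ga] : exists a : A, true.
  by have := gN r; case: (g r) => [[a _]|] //; exists a.
pose p : pretree A V :=
  (r, [ffun v => fparent g v], [ffun v => oapp fst a (g v)]).
have tp : is_tree p.
  have rootE v : (fparent g v == None) = (v == r).
    by have := in_set1 v r; rewrite -rg 2!inE gN.
  apply/andP; split; apply/forallP => v /=; first by rewrite ffunE rootE.
  (* Climbing lowers the rank, so it ends at a vertex without parent, which is [r]. *)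
  have [_ [h hP]] := fg; have [n] := ubnP (h v); elim: n v => // n IH v hv.
  case E: (fparent g v) => [w|]; last first.
    by move/eqP: E; rewrite rootE => /eqP ->; rewrite connect0.
  apply: connect_trans (connect1 _) (IH w _); first by rewrite ffunE E.
  by have := hP _ _ E; lia.
have gE : g = tree_forest (DTree tp).
  apply/ffunP => v; rewrite ffunE /deco /parent /= !ffunE /fparent.
  by have := gN v; case: (g v) => [[b o]|].
by exists (DTree tp) => //; rewrite inE -fprofile_tree -gE pg.
Qed.

End TreeForest.

(** * The symmetric group acting on labelled trees *)

Section Relabel.
Variables (A V : finType).
Implicit Types (t : dtree A V) (s : {perm V}).

Definition relabel_val t s : pretree A V :=
  (s (tree_root t), [ffun v => omap s (parent t (s^-1%g v))],
   [ffun v => deco t (s^-1%g v)]).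

Lemma relabel_is_tree t s : is_tree (relabel_val t s).
Proof.
apply/andP; split; apply/forallP => v /=.
  rewrite ffunE [v == _]eq_sym (can2_eq (permK s) (permKV s)).
  rewrite [_ == s^-1%g v]eq_sym -parent_root.
  by case: (parent t _).
have /andP[_ /forallP/(_ (s^-1%g v))/connectP[p]] := valP t.
rewrite -/(tree_root t) -/(parent t) => vp ->; apply/connectP; exists (map s p).
  rewrite -{1}(permKV s v).
  elim: p (s^-1%g v) vp => //= w p IH u /andP[/eqP uw /IH ->].
  by rewrite ffunE permK -[X in X u]/(parent t) uw eqxx.
by rewrite -{2}(permKV s v) last_map.
Qed.

Definition relabel t s : dtree A V := DTree (relabel_is_tree t s).

(** This makes isomorphism classes orbits, and automorphism groups stabilizers, of relabelling. *)
Lemma tree_isoE t t' s : tree_iso t t' s = (relabel t s == t').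
Proof.
apply/and3P/eqP => [[/eqP sr /forallP sp /forallP sd]|<-].
  apply: val_inj; rewrite /= /relabel_val sr.
  case: t' sr sp sd => [[[r p] d] tp] /= sr sp sd.
  rewrite /tree_root /=; congr (_, _, _); apply/ffunP => v; rewrite ffunE.
    by rewrite -(eqP (sp _)) permKV.
  by rewrite -(eqP (sd _)) permKV.
split=> //; apply/forallP => v; rewrite /parent /deco /= ffunE permK //.
Qed.

Lemma relabel1 t : relabel t 1%g = t.
Proof. by apply/eqP; rewrite -tree_isoE tree_iso1. Qed.

Lemma relabelM t s s' : relabel t (s * s')%g = relabel (relabel t s) s'.
Proof.
by apply/eqP; rewrite -tree_isoE; apply: (tree_isoM (t2 := relabel t s));
  rewrite tree_isoE.
Qed.

Definition relabel_action := TotalAction relabel1 relabelM.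

(** Orbit-stabilizer theorem for relabelling by all permutations of [V]. *)
Lemma card_tree_class t : (#|[set t' | isomorphic t t']| * sigma t = (#|V|)`!)%N.
Proof.
have -> : (#|V|)`! = #|[set: {perm V}]|.
  rewrite -cardsT -(card_perm [set: V]); apply: eq_card => s.
  by rewrite in_setT; apply/subsetP => v _; rewrite in_setT.
rewrite -(card_orbit_stab relabel_action _ t).
congr (_ * _)%N; apply: eq_card => x.
  rewrite inE; apply/existsP/orbitP => [[s]|[s _ <-]]; last first.
    by exists s; rewrite tree_isoE.
  by rewrite tree_isoE => /eqP <-; exists s; rewrite ?inE.
rewrite inE tree_isoE; apply/eqP/idP => [xt|].
  by rewrite inE in_setT; apply/astab1P.
by rewrite inE => /andP[_ /astab1P].
Qed.

Lemma profile_iso t t' : isomorphic t t' -> profile t = profile t'.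
Proof.
move=> /existsP[s /and3P[/eqP sr /forallP sp /forallP sd]].
have fE v : fertility t' (s v) = fertility t v.
  rewrite /fertility -[RHS](card_imset _ (@perm_inj _ s)); apply: eq_card => w.
  rewrite -[w](permKV s) mem_imset; last exact: perm_inj.
  rewrite !inE (eqP (sp _)); case: (parent t _) => //= x.
  by rewrite !(inj_eq Some_inj) (inj_eq perm_inj).
apply/mindexP => -[a j]; rewrite !profileE -[LHS](card_imset _ (@perm_inj _ s)).
apply: eq_card => w; rewrite -[w](permKV s) mem_imset; last exact: perm_inj.
by rewrite !inE fE (eqP (sd _)).
Qed.

End Relabel.

(** With [n = mdegree k], the class of [t] has [n! / sigma t] members, so [1 / sigma t] is its size
    over [n!]; the classes partition the labelled trees. *)
Lemma W_card (A : finType) (K : fieldType) (k : mindex A) :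
  [pchar K] =i pred0 ->
  W K k = #|forests (V := 'I_(mdegree k)) setT 1 k|%:R / (mdegree k)`!%:R.
Proof.
move=> /pcharf0P natK; have fact_neq0 n : n`!%:R != 0 :> K.
  by rewrite natK -lt0n fact_gt0.
rewrite -card_trees -/(trees_of_profile k).
have iso_equiv : {in trees_of_profile k & &,
    equivalence_rel (@isomorphic A 'I_(mdegree k))}.
  by move=> ? ? ? _ _ _; apply: isomorphic_equiv.
have part := equivalence_partitionP iso_equiv.
have trans := transversalP part.
rewrite (card_partition part).
(* The blocks are indexed by their representatives, which turns the sum over classes into one over
   the transversal. *)
rewrite -[X in \sum_(B in pred_of_set X) _](pblock_transversal trans).
rewrite (big_imset _ (pblock_inj trans)) natr_sum mulr_suml.
apply: eq_bigr => t tT.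
have tk : t \in trees_of_profile k by apply: (subsetP (transversal_sub trans)).
(* The block is a full isomorphism class because isomorphic trees share their profile. *)
have -> : finset.pblock (tree_classes k) t = [set t' | isomorphic t t'].
  apply/setP => t'; rewrite inE; apply/idP/idP => [tt'|tt'].
    have t'k : t' \in trees_of_profile k.
      rewrite -(cover_partition part).
      apply/finset.bigcupP; exists (finset.pblock (tree_classes k) t) => //.
      by apply: pblock_mem; rewrite (cover_partition part).
    by rewrite -(pblock_equivalence_partition iso_equiv tk t'k).
  rewrite (pblock_equivalence_partition iso_equiv) //.
  by rewrite inE -(profile_iso tt'); move: tk; rewrite inE.
have := card_tree_class t; rewrite card_ord => E.
have : (sigma t)%:R != 0 :> K.
  rewrite natK; apply/eqP => s0; move: E; rewrite s0 muln0.
  by move=> /esym/eqP; rewrite -leqn0 leqNgt fact_gt0.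
move=> s0; apply: (mulIf s0); rewrite mulVf // mulrAC -natrM E mulfV //.
Qed.

(** * Power series *)

Section PowerSeries.
Variables (A : finType) (K : fieldType).
Implicit Types (S T : fps A K) (k : mindex A).

Lemma fps_mulE S T k :
  fps_mul S T k = \sum_(p <- fset_set (splittings k)) S p.1 * T p.2.
Proof. exact/fsbig_finite/finite_splittings. Qed.

Lemma mem_fset_splittings k p :
  (p \in fset_set (splittings k)) = (p \in splittings k).
Proof. by rewrite in_fset_set //; apply: finite_splittings. Qed.

Lemma splittings_mdegree k p : p \in splittings k ->
  mdegree k = (mdegree p.1 + mdegree p.2)%N.
Proof. by move/set_mem/mdegree_add. Qed.

(** Only a splitting with first part [munit i] contributes, and its second part is then forced. *)
Lemma fps_mul_var i T k :
  fps_mul (fps_var K i) T k = if (0 < k i)%N then T (msub k i) else 0.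
Proof.
rewrite fps_mulE; case: ifP => [ki|ki].
  have pS : (munit i, msub k i) \in fset_set (splittings k).
    by rewrite mem_fset_splittings; apply/mem_set/munit_add_msub.
  rewrite (bigD1_seq _ pS) ?fset_uniq //= /fps_var eqxx mul1r.
  rewrite big_seq_cond big1 ?addr0 //.
  move=> [p q]; rewrite mem_fset_splittings => /andP[/set_mem pqk].
  apply: contraNeq; rewrite mulf_eq0 negb_or /=.
  case: (p =P munit i) => [pi _|]; last by rewrite eqxx.
  rewrite xpair_eqE pi eqxx /=; apply/eqP/mindexP => x.
  by have := pqk x; rewrite /= pi msubE munitE => <-; rewrite addKn.
rewrite big_seq big1 // => -[p q]; rewrite mem_fset_splittings => /set_mem pqk.
rewrite /fps_var /=; case: (p =P munit i) => [pi|]; last by rewrite mul0r.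
by have := pqk i; rewrite /= pi munitE eqxx => ik; rewrite -ik in ki.
Qed.

(** The factor [u_(a, j)] kills every term whose type is absent from [k], which makes the sum over
    [j] finite. *)
Lemma tree_equation_rhsE T k :
  \sum_(a : A) fps_sum (tree_eq_term T a) k =
  \sum_(i <- finsupp k) (arity i)`!%:R^-1 * fps_exp T (arity i) (msub k i).
Proof.
pose G i := (arity i)`!%:R^-1 *
  (if (0 < k i)%N then fps_exp T (arity i) (msub k i) else 0).
have G0 i : i \notin finsupp k -> G i = 0.
  by rewrite mem_finsupp /G lt0n => /negPf ->; rewrite mulr0.
have termE a j : tree_eq_term T a j k = G (a, j).
  by rewrite /tree_eq_term /fps_scale fps_mul_var.
(* The [j] occurring in [k] under any decoration: one finite range serving every [a]. *)
pose s := undup (map snd (finsupp k)).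
have sumE a : fps_sum (tree_eq_term T a) k = \sum_(j <- s) G (a, j).
  rewrite /fps_sum [RHS]fsbig_seq ?undup_uniq //.
  rewrite [RHS](fsbig_widen _ classical_sets.setT) //.
    by apply: eq_fsbigr => j _; rewrite termE.
  move=> j [_ /= js]; rewrite G0 //; apply/negP => kj; apply: js.
  by rewrite mem_undup; apply/mapP; exists (a, j).
under eq_bigr do rewrite sumE.
rewrite -big_enum -[LHS]big_allpairs.
rewrite -(sum_widen (r := finsupp k)) ?fset_uniq //.
- rewrite big_seq [RHS]big_seq; apply: eq_bigr => i.
  rewrite mem_finsupp /G lt0n.
  by move->.
- by rewrite allpairs_uniq ?enum_uniq ?undup_uniq // => -[? ?] [? ?].
- move=> [a j] kj; apply/allpairsP; exists (a, j); rewrite mem_enum mem_undup.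
  by split=> //; apply/mapP; exists (a, j).
Qed.

(** Degree is additive on splittings, so every factor is evaluated at degree at most [mdegree k]. *)
Lemma eq_fps_exp S T n k :
  (forall p, (mdegree p <= mdegree k)%N -> S p = T p) ->
  fps_exp S n k = fps_exp T n k.
Proof.
elim: n k => //= n IH k ST; rewrite /fps_exp /= !fps_mulE big_seq [RHS]big_seq.
apply: eq_bigr => p; rewrite mem_fset_splittings => /splittings_mdegree dk.
rewrite -!/(fps_exp _ _) ST ?dk ?leq_addr //; congr (_ * _).
by apply: IH => q dq; apply: ST; rewrite dk (leq_trans dq) ?leq_addl.
Qed.

(** Strong induction on the degree: the right-hand side at [k] reads the series only up to the
    degree of [msub k i], one less than that of [k]. *)
Lemma tree_equation_unique S T : tree_equation S -> tree_equation T -> S = T.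
Proof.
move=> eS eT; apply/funext => k; have [n] := ubnP (mdegree k).
elim: n k => // n IH k dk; rewrite eS eT !tree_equation_rhsE.
rewrite big_seq [RHS]big_seq; apply: eq_bigr => i.
rewrite mem_finsupp -lt0n => ki.
congr (_ * _); apply: eq_fps_exp => p dp; apply: IH.
by move: dk; rewrite (mdegree_msub ki); lia.
Qed.

(** Exponential generating series of forests with [m] roots; the profile dictates the number of
    vertices. *)
Definition forest_series m : fps A K := fun k =>
  #|forests (V := 'I_(mdegree k)) setT m k|%:R / (mdegree k)`!%:R.

Hypothesis charK : [pchar K] =i pred0.

Lemma natr_neq0 n : (0 < n)%N -> n%:R != 0 :> K.
Proof. by move/pcharf0P: charK => ->; rewrite -lt0n. Qed.

Lemma fact_neq0 n : n`!%:R != 0 :> K.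
Proof. exact/natr_neq0/fact_gt0. Qed.

Lemma forest_series0 : forest_series 0 = fps_one K.
Proof.
apply/funext => k; rewrite /forest_series /fps_one; case: eqP => [->|kN].
  have d0 : mdegree (mzero A) = 0%N by rewrite /mdegree finsupp0 big_seq_fset0.
  have V0 (v : 'I_(mdegree (mzero A))) : False by case: v; rewrite d0.
  (* On an empty vertex set the only preforest is the empty one, a forest without roots. *)
  rewrite (_ : forests _ _ _ = setT).
    by rewrite cardsT card_ffun card_ord d0 divr1.
  apply/setP => g; rewrite in_setT; apply/forestsP; split.
  - by split=> [v|]; [|exists (fun=> 0%N) => v]; case: (V0 v).
  - by apply/setP => v; case: (V0 v).
  - by apply: eq_card0 => v; case: (V0 v).
  - apply/mindexP => i; rewrite fprofileE [RHS]fsfun0E.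
    by apply: eq_card0 => v; case: (V0 v).
rewrite (_ : forests _ _ _ = set0) ?cards0 ?mul0r //.
apply/setP => g; rewrite in_set0; apply/forestsP => -[fg sg /eqP rg _].
have [k0|k_gt0] := posnP (mdegree k); first by case: kN; apply: mdegree_eq0.
have : Ordinal k_gt0 \in fsupp g by rewrite sg in_setT.
move/(forest_root fg) => [r].
by move: rg; rewrite cards_eq0 => /eqP ->; rewrite in_set0.
Qed.

(** Product rule for exponential generating series: the ['C(n, d)] choices of the vertices of the
    tree turn [1 / n!] into [1 / (d! e!)]. *)
Lemma forest_seriesS m k :
  m.+1%:R * forest_series m.+1 k =
  fps_mul (forest_series 1) (forest_series m) k.
Proof.
rewrite fps_mulE /forest_series mulrA -natrM forests_split.
rewrite exchange_big natr_sum mulr_suml big_seq [RHS]big_seq.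
apply: eq_bigr => p.
rewrite mem_fset_splittings => /splittings_mdegree dk.
set d := mdegree p.1; set e := mdegree p.2; set n := mdegree k.
(* A tree of profile [p.1] has [d] vertices, so sets [D] of another size contribute nothing. *)
rewrite (bigID (fun D : {set 'I_n} => #|D| == d)) /=.
rewrite [X in (_ + X)%N]big1 ?addn0; last first.
  by move=> D /eqP Dd; rewrite forests_eq0 // cards0.
rewrite (eq_bigr (fun=> #|forests (V := 'I_d) setT 1 p.1| *
                        #|forests (V := 'I_e) setT m p.2|)%N); last first.
  move=> D /eqP Dd; congr muln; apply: card_forests_ord => //.
  by rewrite cardsCs setCK card_ord Dd /n dk addKn.
rewrite (eq_bigl (fun D => D \in [set D : {set 'I_n} | #|D| == d])); last first.
  by move=> D; rewrite inE.
rewrite sum_nat_const card_draws card_ord.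
have := bin_fact (leq_addr e d); rewrite addKn -[(d + e)%N]dk -/n.
move=> /(congr1 (fun x => x%:R : K)); rewrite !natrM => <-.
have binN : 'C(n, d)%:R != 0 :> K.
  by rewrite natr_neq0 // bin_gt0 /n dk leq_addr.
by field; rewrite !fact_neq0 binN.
Qed.

Lemma fps_exp_forest_series m k :
  fps_exp (forest_series 1) m k = m`!%:R * forest_series m k.
Proof.
elim: m k => [|m IH] k; first by rewrite forest_series0 mul1r.
rewrite factS mulnC natrM -mulrA forest_seriesS /fps_exp iterS -/(fps_exp _ m).
by rewrite !fps_mulE mulr_sumr; apply: eq_bigr => p _; rewrite IH mulrCA.
Qed.

(** The count does not depend on which vertex is the root; with [n = mdegree k], its [n] possible
    positions turn [1 / n!] into [1 / (n - 1)!], where [n - 1] is the degree of [msub k i]. *)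
Lemma forest_series1 k :
  forest_series 1 k = \sum_(i <- finsupp k) forest_series (arity i) (msub k i).
Proof.
rewrite /forest_series forests_root exchange_big natr_sum mulr_suml.
rewrite big_seq [RHS]big_seq; apply: eq_bigr => i.
rewrite mem_finsupp -lt0n => ki.
rewrite (eq_bigr (fun=> #|forests (V := 'I_(mdegree (msub k i))) setT (arity i)
  (msub k i)|)).
  rewrite sum_nat_const card_ord (mdegree_msub ki) factS !natrM.
  by rewrite -mulf_div divff ?natr_neq0 ?mul1r.
move=> r _; apply: card_forests_ord.
by rewrite cardsC1 card_ord (mdegree_msub ki).
Qed.

(** In weight [-1] this is [W_card]; in other weights both sides vanish, since a forest with one
    root has weight [-1]. *)
Lemma tree_seriesE : tree_series A K = forest_series 1.
Proof.
apply/funext => k; rewrite /tree_series /forest_series; case: eqP => [_|wk].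
  exact: W_card.
rewrite (_ : forests _ _ _ = set0) ?cards0 ?mul0r //.
apply/setP => g; rewrite in_set0; apply/forestsP => -[fg _ rg pg].
by case: wk; rewrite -pg weight_fprofile // rg.
Qed.

Lemma tree_equation_tree_series : tree_equation (tree_series A K).
Proof.
move=> k; rewrite tree_equation_rhsE tree_seriesE forest_series1.
(* The factorial produced by the power cancels the one in the equation. *)
by apply: eq_bigr => i _; rewrite fps_exp_forest_series mulKf // fact_neq0.
Qed.

Lemma tree_series_mzero : tree_series A K (mzero A) = 0.
Proof. by rewrite tree_seriesE forest_series1 finsupp0 big_seq_fset0. Qed.

End PowerSeries.

Theorem theorem3p8 (A : finType) (K : fieldType)
    (charK : [pchar K] =i pred0) :
  (tree_series A K (mzero A) = 0 /\ tree_equation (tree_series A K)) /\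
  (forall S : fps A K,
     S (mzero A) = 0 -> tree_equation S -> S = tree_series A K).
Proof.
split.
  by split; [exact: tree_series_mzero|exact: tree_equation_tree_series].
by move=> S _ eS; apply: tree_equation_unique (tree_equation_tree_series charK).
Qed.
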